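(* Let $f,g:\omega\to\omega$ be two functions and let $\mathcal{D}_{k=q}^r$ be a sequence of contractions and broadenings applicable to $f$. If there exists $S\subset\omega_+$ such that $\mathrm{con}(\mathcal{D}_{k=q}^r)\subset S$ and $f(n)\le g(n)$ for all $n\in S$, then $\mathcal{D}_{k=q}^r$ is applicable to $g$, and furthermore for all $n\in\omega$ $$\mathcal{D}_{k=q}^r(f)(n)+g(n)=f(n)+\mathcal{D}_{k=q}^r(g)(n).$$
   Context: $\omega=\{0,1,2,\dots\}$, $\omega_+=\omega\setminus\{0\}$, $[a,b]_\omega=\{n\in\omega:a\le n\le b\}$. The symbol $\subset$ allows equality. A system function $\vartheta:\omega_+\to\{m\in\omega: m\ge 2\}$ is fixed. Contraction: for $f:\omega\to\omega$ and $n\in\omega_+$, the contraction $c_n$ about $n$ is applicable to $f$ iff $f(n+1)\ge\vartheta(n)$, and then $c_n(f)(n)=f(n)+1$, $c_n(f)(n+1)=f(n+1)-\vartheta(n)$, $c_n(f)(k)=f(k)$ for all other $k\in\omega$. Broadening: $b_n$ ($n\in\omega_+$) is applicable to $f$ iff $f(n)\ge 1$, and then $b_n(f)(n)=f(n)-1$, $b_n(f)(n+1)=f(n+1)+\vartheta(n)$, $b_n(f)(k)=f(k)$ for all other $k\in\omega$. Sequences: given a function $\mathcal{D}:\omega\to\{c_n:n\in\omega_+\}\cup\{b_n:n\in\omega_+\}$ and $r\in\omega$, $q\in\omega_+$, the sequence of contractions and broadenings $\mathcal{D}_{k=q}^r$ is the composition $\mathcal{D}(r)\circ\mathcal{D}(r-1)\circ\dots\circ\mathcal{D}(q)$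 (so $\mathcal{D}(q)$ is performed first). If $r<q$ then $\mathcal{D}_{k=q}^r(f)=f$ and the sequence is applicable to every $f$. Otherwise $\mathcal{D}_{k=q}^r$ is applicable to $f$ iff for every $k\in[q,r]_\omega$ the move $\mathcal{D}(k)$ is applicable to $\mathcal{D}_{j=q}^{k-1}(f)$. The conditional of $\mathcal{D}_{k=q}^r$ is $$\mathrm{con}(\mathcal{D}_{k=q}^r)=\{n+1: n\in\omega_+,\ \exists k\in[q,r]_\omega,\ \mathcal{D}(k)=c_n\}\cup\{n\in\omega_+: \exists k\in[q,r]_\omega,\ \mathcal{D}(k)=b_n\}.$$ *)

(* Defs.v *)
From mathcomp Require Import all_boot.
From mathcomp Require Import classical_sets.

Set Implicit Arguments.
Unset Strict Implicit.
Unset Printing Implicit Defensive.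

Local Open Scope classical_set_scope.
Local Open Scope nat_scope.

Definition nat_ge (m : nat) : Type := {n : nat | m <= n}.
Definition nat_of_nat_ge (m : nat) (n : nat_ge m) : nat := sval n.
Coercion nat_of_nat_ge : nat_ge >-> nat.

Definition pos_nat : Type := nat_ge 1.
Definition system_function : Type := pos_nat -> nat_ge 2.

Identity Coercion nat_ge_of_pos_nat : pos_nat >-> nat_ge.

(* The formal moves stand for the partial operators c_n and b_n; these operators
   are pairwise distinct, so equality of moves is equality of operators. *)
Inductive cb_move : Type :=
  | contraction of pos_nat
  | broadening of pos_nat.

Definition applicable (theta : system_function) (d : cb_move)
    (f : nat -> nat) : Prop :=
  match d with
  | contraction n => theta n <= f n.+1
  | broadening n => 1 <= f n
  end.

(* The partial operators are totalized by truncated subtraction, which agrees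
   with true subtraction exactly when the move is applicable. *)
Definition perform (theta : system_function) (d : cb_move)
    (f : nat -> nat) : nat -> nat :=
  match d with
  | contraction n => fun k =>
      if k == n then f n + 1
      else if k == n.+1 then f n.+1 - theta n
      else f k
  | broadening n => fun k =>
      if k == n then f n - 1
      else if k == n.+1 then f n.+1 + theta n
      else f k
  end.

(* D(r) o ... o D(q); index_iota q r.+1 lists q, ..., r in increasing order and
   is empty when r < q. *)
Definition perform_seq (theta : system_function) (D : nat -> cb_move)
    (q : pos_nat) (r : nat) (f : nat -> nat) : nat -> nat :=
  foldl (fun h k => perform theta (D k) h) f (index_iota q r.+1).

(* Since q >= 1, the predecessor k.-1 below is the true k - 1. For r < q the
   condition is vacuous. *)
Definition applicable_seq (theta : system_function) (D : nat -> cb_move)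
    (q : pos_nat) (r : nat) (f : nat -> nat) : Prop :=
  forall k : nat, q <= k <= r ->
    applicable theta (D k) (perform_seq theta D q k.-1 f).

Definition con (D : nat -> cb_move) (q : pos_nat) (r : nat) : set nat :=
  [set (n : nat).+1 | n in
    [set n : pos_nat | exists2 k : nat, q <= k <= r & D k = contraction n]]
  `|`
  [set (n : nat) | n in
    [set n : pos_nat | exists2 k : nat, q <= k <= r & D k = broadening n]].

(* Main.v *)
Require Import Defs.
From mathcomp Require Import all_boot.
From mathcomp Require Import classical_sets.
From mathcomp Require Import zify.

(* The identity says that the difference between the two functions is preserved
   by every move.  Hence at each step the iterate of g still dominates the
   iterate of f on the conditional, which is the only place where applicability
   is tested; so the next move is applicable to the iterate of g as well, and
   the identity passes to the next step. *)

Local Open Scope classical_set_scope.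
Local Open Scope nat_scope.

(** The one argument whose value decides applicability of [d]; also what [d] contributes to
    [con]. *)
Definition tested_index (d : cb_move) : nat :=
  match d with
  | contraction n => n.+1
  | broadening n => n
  end.

Lemma con_tested_index (D : nat -> cb_move) (q : pos_nat) (r k : nat) :
  q <= k <= r -> con D q r (tested_index (D k)).
Proof.
move=> qkr; case Dk: (D k) => [n|n]; [left|right];
  by exists n => //; exists k.
Qed.

Lemma applicable_le (theta : system_function) (d : cb_move) (f g : nat -> nat) :
  f (tested_index d) <= g (tested_index d) ->
  applicable theta d f -> applicable theta d g.
Proof. by case: d => n /= fg h; apply: leq_trans h fg. Qed.

(** At each argument a move adds or subtracts an amount that does not depend on the function;
    applicability to both [f'] and [g'] keeps the subtraction from being truncated. *)
Lemma perform_difference (theta : system_function) (d : cb_move)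
    (f g f' g' : nat -> nat) :
  applicable theta d f' -> applicable theta d g' ->
  (forall n, f' n + g n = f n + g' n) ->
  forall n, perform theta d f' n + g n = f n + perform theta d g' n.
Proof.
case: d => m /= af ag fg n; have := fg n;
  (case: (n =P m :> nat) => [->|_]; last case: (n =P m.+1) => [->|_]); lia.
Qed.

Lemma perform_seq_nil (theta : system_function) (D : nat -> cb_move)
    (q : pos_nat) (r : nat) (f : nat -> nat) :
  r < q -> perform_seq theta D q r f = f.
Proof. by rewrite /perform_seq /index_iota -subn_eq0 => /eqP->. Qed.

Lemma perform_seq_recr (theta : system_function) (D : nat -> cb_move)
    (q : pos_nat) (r : nat) (f : nat -> nat) :
  q <= r.+1 ->
  perform_seq theta D q r.+1 f =
    perform theta (D r.+1) (perform_seq theta D q r f).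
Proof.
move=> qr; rewrite /perform_seq /index_iota subSn //.
rewrite -[(_ - _).+1]addn1 iotaD foldl_cat /=.
by rewrite subnKC.
Qed.

(** Domination is asked step by step instead of on a set [S], so it restricts to shorter sequences
    in the induction on [r]. *)
Lemma perform_seq_difference (theta : system_function) (D : nat -> cb_move)
    (q : pos_nat) (r : nat) (f g : nat -> nat) :
  applicable_seq theta D q r f ->
  (forall k, q <= k <= r -> f (tested_index (D k)) <= g (tested_index (D k))) ->
  applicable_seq theta D q r g /\
  (forall n,
     perform_seq theta D q r f n + g n = f n + perform_seq theta D q r g n).
Proof.
elim: r => [|r IHr] af fg.
  (* As [q] is positive, the sequence ending at 0 is empty. *)
  have q_gt0 : 0 < q := svalP q.
  by split=> [k|n]; [lia | rewrite !perform_seq_nil].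
have [ag diff] : applicable_seq theta D q r g /\ (forall n,
    perform_seq theta D q r f n + g n = f n + perform_seq theta D q r g n).
  by apply: IHr => k qkr; [apply: af | apply: fg]; lia.
have [rq|qr] := ltnP r.+1 q.
  by split=> [k|n]; [lia | rewrite !perform_seq_nil].
have qrr : q <= r.+1 <= r.+1 by rewrite qr leqnn.
have agr : applicable theta (D r.+1) (perform_seq theta D q r g).
  (* At the tested index, [diff] turns [f <= g] into the same inequality between the iterates up to
     [r], the predecessor of [r.+1]. *)
  apply: applicable_le (af _ qrr) => /=.
  have := diff (tested_index (D r.+1)); have := fg _ qrr; lia.
split=> [k /andP[qk]|].
  rewrite leq_eqVlt => /predU1P[->//|kr].
  by apply: ag; rewrite qk.
rewrite !perform_seq_recr //.
exact: perform_difference (af _ qrr) agr diff.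
Qed.

Theorem theorem3p2p3 (theta : system_function) (f g : nat -> nat)
    (D : nat -> cb_move) (q : pos_nat) (r : nat) :
  applicable_seq theta D q r f ->
  (exists S : set nat,
     [/\ S `<=` [set n | 0 < n], con D q r `<=` S
       & forall n : nat, S n -> f n <= g n]) ->
  applicable_seq theta D q r g /\
  (forall n : nat,
     perform_seq theta D q r f n + g n = f n + perform_seq theta D q r g n).
Proof.
move=> af [S [_ conS fg]]; apply: perform_seq_difference => // k qkr.
by apply/fg/conS/con_tested_index.
Qed.
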